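(* (1) If $(\alpha^*,u^* )$ is an inverse Stackelberg solution of the differential game, then with $u_0^*=\alpha^*[u^*]$ we have $(u_0^*,u^* )\in\mathcal{C}$ and $(u_0^*,u^* )$ maximizes $J_0(u_0,u)$ over $(u_0,u)\in\mathcal{C}$. (2) Conversely, if $(u_0^*,u^* )\in\mathcal{C}$ maximizes $J_0$ over $\mathcal{C}$, then there exists a nonanticipative strategy $\alpha^*$ of the leader such that $\alpha^*[u^*]=u_0^*$ and $(\alpha^*,u^* )$ is an inverse Stackelberg solution.
   Context: Differential game with leader (player $0$) and followers $1,\dots,n$ on $[0,T]$, initial state $x_0\in\mathbb{R}^d$. Control sets $P_0,\dots,P_n$ are compact metric spaces. The functions $f:[0,T]\times\mathbb{R}^d\times P_0\times\dots\times P_n\to\mathbb{R}^d$, $g_i:[0,T]\times\mathbb{R}^d\times P_0\times\dots\times P_n\to\mathbb{R}$ and $\sigma_i:\mathbb{R}^d\to\mathbb{R}$ ($i=0,\dots,n$) are continuous, and $f$ is Lipschitz in $x$ with sublinear growth, so trajectories below exist and are unique. $\mathcal{U}_i$ is the set of measurable maps $[0,T]\to P_i$ (open-loop strategies), $\mathcal{U}=\mathcal{U}_1\times\dots\times\mathcal{U}_n$ (profiles), and $(u_i',u_{-i})$ denotes the profile $u$ with $i$-th component replaced by $u_i'$. For $(t_*,x_* )\in[0,T]\times\mathbb{R}^d$, $u_0\in\mathcal{U}_0$, $u\in\mathcal{U}$, $x(\cdot,t_*,x_*,u_0,u)$ is the solution on $[t_*,T]$ of $\dot x(t)=f(t,x(t),u_0(t),u_1(t),\dots,u_n(t))$,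 $x(t_* )=x_*$; $z_i(t,t_*,x_*,u_0,u)=\int_{t_*}^t g_i(s,x(s),u_0(s),u(s))\,ds$; and $J_i(t_*,x_*,u_0,u)=\sigma_i(x(T,t_*,x_*,u_0,u))+z_i(T,t_*,x_*,u_0,u)$. Arguments $t_*,x_*$ are omitted when $t_*=0,x_*=x_0$. Standing assumption: for every $(t_*,x_* )$ the set $\{(x(\cdot,t_*,x_*,u_0,u),z(\cdot,t_*,x_*,u_0,u)):u_0\in\mathcal{U}_0,u\in\mathcal{U}\}$ (with $z=(z_0,\dots,z_n)$) is closed in the space of continuous functions. A nonanticipative strategy of the leader is a map $\alpha:\mathcal{U}\to\mathcal{U}_0$ such that for every $\tau$, if $u,u'$ coincide on $[0,\tau]$ then $\alpha[u]$ and $\alpha[u']$ coincide on $[0,\tau]$; the same notion is used on any interval $[t_*,T]$. Put $J_i[t_*,x_*,\alpha,u]=J_i(t_*,x_*,\alpha[u],u)$. The set of followers' Nash equilibria is $\mathcal{E}_d(\alpha)=\{u\in\mathcal{U}: J_i[\alpha,u]\ge J_i[\alpha,(u_i',u_{-i})]\ \text{for all } i=1,\dots,n,\ u_i'\in\mathcal{U}_i\}$. A pair $(\alpha^*,u^* )$ is an inverse Stackelberg solution of the differential game if $u^*\in\mathcal{E}_d(\alpha^* )$ and $J_0[\alpha^*,u^*]=\sup_{\alpha}\sup_{u\in\mathcal{E}_d(\alpha)}J_0[\alpha,u]$ (over all nonanticipative strategies $\alpha$; $\sup\emptyset=-\infty$). The lower value of the zero-sum game between the leader and follower $i$ is $V_i^-(t_*,x_*,u_{-i})=\min_{\alpha}\max_{u_i'\in\mathcal{U}_i}J_i[t_*,x_*,\alpha,(u_i',u_{-i})]$,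 where controls and nonanticipative strategies are taken on $[t_*,T]$ (the minimum and maximum are assumed attained). Finally $\mathcal{C}=\{(u_0,u)\in\mathcal{U}_0\times\mathcal{U}: J_i(t,x(t),u_0,u)\ge V_i^-(t,x(t),u_{-i})\ \text{for all } t\in[0,T],\ i=1,\dots,n,\ \text{where } x(\cdot)=x(\cdot,0,x_0,u_0,u)\}$, the payoffs from $(t,x(t))$ using the restrictions of $u_0,u$ to $[t,T]$. *)

(* Defs.v *)
From HB Require Import structures.
From mathcomp Require Import all_boot all_order all_algebra.
From mathcomp Require Import all_classical all_reals all_analysis.
Set Implicit Arguments. Unset Strict Implicit. Unset Printing Implicit Defensive.
Import Order.TTheory GRing.Theory Num.Theory.
Import numFieldNormedType.Exports.
Local Open Scope classical_set_scope.
Local Open Scope ring_scope.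

(* Differential game with leader (player 0) and followers 1..n on [0,T].
   Players are indexed by 'I_n.+1: ord0 is the leader, follower i : 'I_n
   is player (lift ord0 i).  States live in R^d = 'rV[R]_d.
   A control is a total map R -> P; only its values on the relevant time
   interval matter. *)

Section Game.
Variables (R : realType) (T : R) (d n : nat).
Variables (P0 : pseudoMetricType R) (P : 'I_n -> pseudoMetricType R).
Variable f : R -> 'rV[R]_d -> P0 -> (forall i : 'I_n, P i) -> 'rV[R]_d.
Variable g : 'I_n.+1 -> R -> 'rV[R]_d -> P0 -> (forall i : 'I_n, P i) -> R.
Variable sigma : 'I_n.+1 -> 'rV[R]_d -> R.

Definition profile := forall i : 'I_n, R -> P i.
Definition at_time (u : profile) (s : R) : forall i : 'I_n, P i :=
  fun i => u i s.

Definition meas_ctrl (Q : pseudoMetricType R) (t0 : R) (v : R -> Q) :=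
  forall O : set Q, open O -> measurable (`[t0, T] `&` v @^-1` O).

Definition adm0 (t0 : R) (u0 : R -> P0) := meas_ctrl t0 u0.
Definition adm (t0 : R) (u : profile) := forall i, meas_ctrl t0 (u i).

(* x is a (Caratheodory) solution on [t0,T] of
   x' = f(t,x,u0,u), x(t0) = x0 *)
Definition is_traj (t0 : R) (x0 : 'rV[R]_d) (u0 : R -> P0) (u : profile)
  (x : R -> 'rV[R]_d) :=
  {within `[t0, T], continuous x} /\
  forall t, t0 <= t <= T -> forall k : 'I_d,
    x t 0 k = x0 0 k +
      \int[lebesgue_measure]_(s in `[t0, t]) (f s (x s) (u0 s) (at_time u s) 0 k).

Definition traj (t0 : R) (x0 : 'rV[R]_d) (u0 : R -> P0) (u : profile)
  : R -> 'rV[R]_d :=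
  xget (fun _ => 0) (is_traj t0 x0 u0 u).

Definition zpay (j : 'I_n.+1) (t t0 : R) (x0 : 'rV[R]_d) (u0 : R -> P0)
  (u : profile) : R :=
  \int[lebesgue_measure]_(s in `[t0, t])
     (g j s (traj t0 x0 u0 u s) (u0 s) (at_time u s)).

Definition Jpay (j : 'I_n.+1) (t0 : R) (x0 : 'rV[R]_d) (u0 : R -> P0)
  (u : profile) : R :=
  sigma j (traj t0 x0 u0 u T) + zpay j T t0 x0 u0 u.

Definition nonanticipative (t0 : R) (alpha : profile -> R -> P0) :=
  (forall u, adm t0 u -> adm0 t0 (alpha u)) /\
  forall u u' tau, adm t0 u -> adm t0 u' -> t0 <= tau <= T ->
    (forall i s, t0 <= s <= tau -> u i s = u' i s) ->
    forall s, t0 <= s <= tau -> alpha u s = alpha u' s.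

Definition deviate (u : profile) (i : 'I_n) (v : R -> P i) : profile :=
  @dfwith _ (fun j => R -> P j) u i v.

Definition Nash_set (x0 : 'rV[R]_d) (alpha : profile -> R -> P0)
  : set profile :=
  [set u | adm 0 u /\
    forall (i : 'I_n) (v : R -> P i), meas_ctrl 0 v ->
      Jpay (lift ord0 i) 0 x0 (alpha (deviate u v)) (deviate u v)
        <= Jpay (lift ord0 i) 0 x0 (alpha u) u].

Definition inv_stackelberg (x0 : 'rV[R]_d) (alpha : profile -> R -> P0)
  (u : profile) :=
  nonanticipative 0 alpha /\ Nash_set x0 alpha u /\
  ((Jpay ord0 0 x0 (alpha u) u)%:E =
     ereal_sup [set ereal_sup
        [set (Jpay ord0 0 x0 (a (w : profile)) w)%:E | w in Nash_set x0 a]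
       | a in nonanticipative 0])%E.

Definition dev_sup (t0 : R) (x0 : 'rV[R]_d) (i : 'I_n) (u : profile)
  (alpha : profile -> R -> P0) : \bar R :=
  ereal_sup [set (Jpay (lift ord0 i) t0 x0 (alpha (deviate u v))
                     (deviate u v))%:E | v in @meas_ctrl (P i) t0].

(* lower value V_i^-(t0, x0, u_{-i}) of the zero-sum game leader vs i *)
Definition Vlow (t0 : R) (x0 : 'rV[R]_d) (i : 'I_n) (u : profile) : \bar R :=
  ereal_inf [set dev_sup t0 x0 i u a | a in nonanticipative t0].

Definition Cset (x0 : 'rV[R]_d) : set ((R -> P0) * profile) :=
  [set p | adm0 0 p.1 /\ adm 0 p.2 /\
    forall t, 0 <= t <= T -> forall i : 'I_n,
      (Vlow t (traj 0 x0 p.1 p.2 t) i p.2 <=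
       (Jpay (lift ord0 i) t (traj 0 x0 p.1 p.2 t) p.1 p.2)%:E)%E].

Definition jcont (V : normedModType R)
  (h : R -> 'rV[R]_d -> P0 -> (forall i : 'I_n, P i) -> V) :=
  forall t x p0 p, 0 <= t <= T -> forall e : R, 0 < e ->
  exists2 del : R, 0 < del & forall t' x' p0' p', 0 <= t' <= T ->
    `|t - t'| < del -> `|x - x'| < del -> ball p0 del p0' ->
    (forall i, ball (p i) del (p' i)) ->
    `|h t x p0 p - h t' x' p0' p'| < e.

Definition f_lipschitz :=
  exists L : R, forall t x y p0 p, 0 <= t <= T ->
    `|f t x p0 p - f t y p0 p| <= L * `|x - y|.

Definition f_sublinear :=
  exists C : R, forall t x p0 p, 0 <= t <= T ->
    `|f t x p0 p| <= C * (1 + `|x|).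

(* trajectories exist and are unique (consequence of the above) *)
Definition well_posed :=
  forall t0 x0 u0 u, 0 <= t0 <= T -> adm0 t0 u0 -> adm t0 u ->
    (exists x, is_traj t0 x0 u0 u x) /\
    (forall x y, is_traj t0 x0 u0 u x -> is_traj t0 x0 u0 u y ->
       forall t, t0 <= t <= T -> x t = y t).

(* closedness of {(x(.),z(.))} in C([t0,T]) (sequential form, uniform
   convergence) *)
Definition closed_reach :=
  forall t0 x0, 0 <= t0 <= T ->
  forall (u0s : nat -> R -> P0) (us : nat -> profile)
         (X : R -> 'rV[R]_d) (Z : 'I_n.+1 -> R -> R),
    (forall k, adm0 t0 (u0s k) /\ adm t0 (us k)) ->
    (forall e : R, 0 < e -> exists N, forall k, (N <= k)%N ->
       forall s, t0 <= s <= T ->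
         `|traj t0 x0 (u0s k) (us k) s - X s| < e /\
         forall j, `|zpay j s t0 x0 (u0s k) (us k) - Z j s| < e) ->
    exists u0 u, adm0 t0 u0 /\ adm t0 u /\
      forall s, t0 <= s <= T ->
        traj t0 x0 u0 u s = X s /\ forall j, zpay j s t0 x0 u0 u = Z j s.

Definition value_attained :=
  forall t0 x0 (i : 'I_n) u, 0 <= t0 <= T -> adm t0 u ->
    exists alpha, nonanticipative t0 alpha /\
      dev_sup t0 x0 i u alpha = Vlow t0 x0 i u /\
      exists2 v : R -> P i, meas_ctrl t0 v &
        (Jpay (lift ord0 i) t0 x0 (alpha (deviate u v)) (deviate u v))%:E
          = dev_sup t0 x0 i u alpha.

End Game.

(* Main.v *)
(* Payoffs obey dynamic programming: if (v0, v) follows (u0, u) before time t,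
   then J_i(v0, v) is what i collects along (u0, u) up to t plus J_i of the tail
   of (v0, v) started from x(t).  Splitting the integrals needs integrability,
   which comes from approximating the controls by countably-valued ones
   (measurability) and from compactness of the control sets (boundedness).

   If u is a Nash equilibrium for alpha, then alpha played after the history u
   on [0, t) is a strategy on [t, T] against which follower i cannot beat
   J_i(t, x(t), alpha[u], u), so V_i^- is at most that number and (alpha[u], u)
   lies in C.  Conversely, for (u0, u) in C the leader plays u0 as long as the
   followers play u, and then switches to an optimal response to a follower i
   who deviated first, which gives i at most V_i^-(t, x(t)) <= J_i(t, x(t), u0, u).
   Hence C is exactly the set of outcomes of equilibria. *)

Require Import Defs.
From HB Require Import structures.
From mathcomp Require Import all_boot all_order all_algebra.
From mathcomp Require Import all_classical all_reals all_analysis measurable_realfun.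
Set Implicit Arguments.
Unset Strict Implicit.
Unset Printing Implicit Defensive.
Import Order.TTheory GRing.Theory Num.Theory.
Import numFieldNormedType.Exports.
Local Open Scope classical_set_scope.
Local Open Scope ring_scope.

(** * Finite nets and countably-valued approximations of measurable controls *)

Lemma compact_net (R : realType) (Q : pseudoMetricType R) (e : R) :
  compact [set: Q] -> 0 < e ->
  exists s : seq Q, forall q, exists2 c, c \in s & interior (ball c e) q.
Proof.
move=> /compact_near_coveringP cQ e0.
(* Finite lists are ordered by inclusion. Near any [q], every list containing [q] works, and
   compactness merges these local choices into one list. *)
pose F : set_system (seq Q) :=
  filter_from [set: seq Q] (fun s : seq Q => [set s' : seq Q | {subset s <= s'}]).
have FF : Filter F.
  apply: filter_from_filter; first by exists [::].
  move=> s s' _ _; exists (s ++ s') => // t st; split=> x xs; apply: st;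
    by rewrite mem_cat xs ?orbT.
have : F (fun s => forall q, [set: Q] q ->
    exists2 c, c \in s & interior (ball c e) q).
  apply: (cQ _ F) => q _.
  exists (interior (ball q e), [set s' : seq Q | {subset [:: q] <= s'}]).
    split => /=; last by exists [:: q].
    by apply: nbhs_interior; exact: nbhsx_ballx.
  by move=> [q' s] /= [q'q /(_ q)]; rewrite mem_head => /(_ isT) qs; exists q.
by case=> s _ /(_ s) /= h; exists s => q; apply: h.
Qed.

(** Each time is sent to the first ball of a finite net that captures [v s], so a level set of [idx]
    is a finite Boolean combination of preimages of open sets. Interiors are taken because a ball
    need not be open. *)
Lemma ctrl_index (R : realType) (T t0 e : R) (Q : pseudoMetricType R)
    (v : R -> Q) :
  compact [set: Q] -> meas_ctrl T t0 v -> 0 < e ->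
  exists (c : nat -> Q) (idx : R -> nat),
    (forall j, measurable (`[t0, T] `&` idx @^-1` [set j])) /\
    forall s, ball (c (idx s)) e (v s).
Proof.
move=> cQ mv e0; have [net netP] := compact_net cQ e0.
pose p r := [pred c | `[< interior (ball c e) (v r) >]].
exists (nth (v 0) net), (fun r => find (p r) net); split; last first.
  move=> s; have [c cn cs] := netP (v s); apply: interior_subset.
  by apply/asboolP/(@nth_find _ (v 0) (p s))/hasP; exists c => //; apply/asboolP.
elim: net {netP} => [|c net IH] j /=.
  case: j => [|j].
    by rewrite [X in measurable X](_ : _ = `[t0, T]%classic)//;
      apply/seteqP; split=> // r [].
  by rewrite [X in measurable X](_ : _ = set0)//; apply/seteqP; split=> // r [].
have mc : measurable (`[t0, T] `&` v @^-1` interior (ball c e)).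
  by apply: mv; exact: open_interior.
case: j => [|j].
  rewrite [X in measurable X](_ : _ = `[t0, T] `&` v @^-1` interior (ball c e))//.
  apply/seteqP; split=> r [rI]; rewrite /preimage/=; case: asboolP => //.
(* Index [j.+1] means: missed by the first ball, and index [j] in the rest of the net. *)
rewrite [X in measurable X](_ : _ =
  (`[t0, T] `&` (fun r => find (p r) net) @^-1` [set j]) `\`
  (`[t0, T] `&` v @^-1` interior (ball c e))); first exact: measurableD.
apply/seteqP; split=> r; rewrite /preimage/=; case: asboolP => //.
- by move=> _ [].
- by move=> ? [rI [<-]]; split => // -[].
- by move=> ? [[rI <-] []].
- by move=> ? [[rI <-] _].
Qed.

(** The domain is a countable union of level sets of [idx], on each of which the map is a single
    [F j]. *)
Lemma measurable_fun_countable_index (R : realType) (D : set R) (J : countType)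
    (idx : R -> J) (F : J -> R -> R) :
  measurable D -> (forall j, measurable (D `&` idx @^-1` [set j])) ->
  (forall j, measurable_fun D (F j)) ->
  measurable_fun D (fun s => F (idx s) s).
Proof.
move=> mD mi mF.
pose E k := D `&` (fun s => pickle (idx s)) @^-1` [set k].
have EE k : E k = set0 \/ exists j, E k = D `&` idx @^-1` [set j].
  have [[j jk]|nk] := pselect (exists j : J, pickle j = k).
    right; exists j; apply/seteqP; split=> s [Ds]; rewrite /E/= => ej; split=> //.
      by move: ej; rewrite -jk => /(pcan_inj pickleK).
    by rewrite /= ej jk.
  left; apply/seteqP; split=> // s [Ds /= sk].
  by apply: nk; exists (idx s).
have DE : D = \bigcup_k E k.
  by apply/seteqP; split=> [s Ds|s [k _ []//]]; exists (pickle (idx s)).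
rewrite DE; apply/measurable_fun_bigcup => k.
  by case: (EE k) => [->//|[j ->]].
case: (EE k) => [->|[j ->]]; first exact: measurable_fun_set0.
apply: (@eq_measurable_fun _ _ _ _ _ (F j)).
  by move=> s; rewrite inE => -[_ /= ->].
by apply: measurable_funS (mF j) => // s [].
Qed.

(** * Integrability of running payoffs *)

Section RunningPayoff.
Variables (R : realType) (T : R) (d n : nat).
Variables (P0 : pseudoMetricType R) (P : 'I_n -> pseudoMetricType R).
Hypotheses (cP0 : compact [set: P0]) (cP : forall i, compact [set: P i]).
Variables (h : R -> 'rV[R]_d -> P0 -> (forall i : 'I_n, P i) -> R).
Hypothesis hc : jcont T h.
Variables (t0 : R) (x : R -> 'rV[R]_d) (u0 : R -> P0) (u : profile P).
Hypotheses (t0_ge0 : 0 <= t0) (xc : {within `[t0, T], continuous x}).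

Lemma running_within_continuous p0 p :
  {within `[t0, T], continuous (fun s => h s (x s) p0 p)}.
Proof.
apply/subspace_continuousP => s sI; apply/cvgrPdist_lt => e e0.
have sT : 0 <= s <= T.
  by move: sI; rewrite /= in_itv/= => /andP[ts ->]; rewrite (le_trans t0_ge0).
have [del del0 hdel] := hc (x s) p0 p sT e0.
move: xc => /subspace_continuousP /(_ s sI) /cvgrPdist_lt /(_ _ del0).
move=> xs; change (nbhs s (fun r => `[t0, T]%classic r ->
  `|h s (x s) p0 p - h r (x r) p0 p| < e)).
have {}xs : nbhs s (fun r => `[t0, T]%classic r -> `|x s - x r| < del) by [].
apply: filterS2 (nbhsx_ballx s del del0) xs => r sr xsr rI.
apply: hdel => //; last by move=> i; exact: ballxx.
- by move: rI; rewrite /= in_itv/= => /andP[tr ->]; rewrite (le_trans t0_ge0).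
- exact: xsr.
- exact: ballxx.
Qed.

Hypotheses (mu0 : adm0 T t0 u0) (mu : adm T t0 u).

(** With controls frozen, [h] is continuous in time along [x]. Replacing the controls by net points
    within [k.+1%:R^-1] thus gives measurable functions, which converge pointwise by joint
    continuity of [h]. *)
Lemma measurable_running :
  measurable_fun `[t0, T] (fun s => h s (x s) (u0 s) (at_time u s)).
Proof.
have e0 k : 0 < k.+1%:R^-1 :> R by rewrite invr_gt0.
pose I0 k := cid (ctrl_index cP0 mu0 (e0 k)).
pose c0 k := sval (I0 k).
pose J0 k := cid (svalP (I0 k)).
pose i0 k := sval (J0 k).
pose Ii k i := cid (ctrl_index (@cP i) (@mu i) (e0 k)).
pose ci k i := sval (Ii k i).
pose Ji k i := cid (svalP (Ii k i)).
pose ii k i := sval (Ji k i).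
(* The followers' indices are packed into a finite function so that the whole index lives in a
   countable type. *)
pose idx k s : nat * {ffun 'I_n -> nat} := (i0 k s, [ffun i => ii k i s]).
pose H k (j : nat * {ffun 'I_n -> nat}) s :=
  h s (x s) (c0 k j.1) (fun i => ci k i (j.2 i)).
apply: (@measurable_fun_cvg _ _ _ _ (fun k s => H k (idx k s) s)).
  move=> k; apply: (measurable_fun_countable_index (F := H k)) => //.
    move=> j.
    rewrite [X in measurable X](_ : _ = (`[t0, T] `&` i0 k @^-1` [set j.1]) `&`
      \bigcap_(i in [set: 'I_n]) (`[t0, T] `&` ii k i @^-1` [set j.2 i])).
      apply: measurableI; first exact: (svalP (J0 k)).1.
      by apply: fin_bigcap_measurable => // i _; exact: (svalP (Ji k i)).1.
    apply/seteqP; split=> s /=.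
      move=> [sI <-]; split => // i _; split => //=; by rewrite ffunE.
    move=> [[sI s0] si]; split => //; rewrite /idx /=.
    case: j s0 si => j1 j2 /= -> si; congr pair; apply/ffunP => i.
    by rewrite ffunE; have [_ /= ->] := si i I.
  move=> j; apply: subspace_continuous_measurable_fun => //.
  exact: running_within_continuous.
move=> s sI; apply/cvgrPdist_lt => e epos.
have sT : 0 <= s <= T.
  by move: sI; rewrite /= in_itv/= => /andP[ts ->]; rewrite (le_trans t0_ge0).
have [del del0 hdel] := hc (x s) (u0 s) (at_time u s) sT epos.
have := near_infty_natSinv_lt (PosNum del0); apply: filterS => k /= /ltW kdel.
apply: hdel => //; rewrite ?subrr ?normr0 //.
- apply: (le_ball kdel); apply/ball_sym.
  exact: (svalP (J0 k)).2.
- move=> i; apply: (le_ball kdel); apply/ball_sym; rewrite /= ffunE.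
  exact: (svalP (Ji k i)).2.
Qed.

(** Along [x] the function [h] is locally bounded in time and controls, and times together with
    controls form a compact set by Tychonoff's theorem. *)
Lemma running_bounded : [bounded h s (x s) (u0 s) (at_time u s) | s in `[t0, T]].
Proof.
pose K := (`[t0, T]%classic : set R) `*` (([set: P0]) `*`
  [set p : prod_topology P | forall i, [set: P i] (p i)]).
have cK : compact K.
  apply: compact_setX; first exact: segment_compact.
  by apply: compact_setX => //; exact: (@tychonoff _ P (fun=> setT) cP).
pose Q (M : R) (y : R * (P0 * prod_topology P)) := `[t0, T]%classic y.1 ->
  `|h y.1 (x y.1) y.2.1 y.2.2| <= M.
suff : \forall M \near +oo, forall y, K y -> Q M y.
  apply: filterS => M QM s sI; exact: (QM (s, (u0 s, at_time u s))).
move/compact_near_coveringP : cK; apply => -[s [p0 p]] [/= sI _].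
have sT : 0 <= s <= T.
  by move: sI; rewrite /= in_itv/= => /andP[ts ->]; rewrite (le_trans t0_ge0).
have [del del0 hdel] := hc (x s) p0 p sT ltr01.
move: xc => /subspace_continuousP /(_ s sI) /cvgrPdist_lt /(_ _ del0).
move=> xs.
pose A : set R := [set r | `|s - r| < del /\ (`[t0, T]%classic r -> `|x s - x r| < del)].
have sA : nbhs s A.
  by apply: filterI => //; exact: (nbhsx_ballx s del del0).
pose B : set (prod_topology P) := [set p' | forall i, ball (p i) del (p' i)].
(* The box is a neighbourhood because there are finitely many followers. *)
have pB : nbhs (p : prod_topology P) B.
  apply: (@filter_forall _ _
    (fun i (p' : prod_topology P) => ball (p i) del (p' i))
    (nbhs (p : prod_topology P))) => i.
  by apply: (@proj_continuous _ P i p); exact: nbhsx_ballx.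
pose C := ball p0 del.
have pC : nbhs p0 C by exact: nbhsx_ballx.
exists (A `*` (C `*` B), [set M : R | `|h s (x s) p0 p| + 1 <= M]) => /=.
  split; last by apply: nbhs_pinfty_ge; rewrite num_real.
  by exists (A, C `*` B) => //; split=> //; exists (C, B).
move=> [[r [q0 q]] M] /= [[[Ar Axr] [Cq Bq]] hM] rI; apply: le_trans hM.
have rT : 0 <= r <= T.
  by move: rI; rewrite /= in_itv/= => /andP[tr ->]; rewrite (le_trans t0_ge0).
have /= := hdel r (x r) q0 q rT Ar (Axr rI) Cq Bq.
rewrite distrC => /ltW; rewrite -(lerD2l `|h s (x s) p0 p|); apply: le_trans.
by rewrite -{1}(subrKC (h s (x s) p0 p) (h r (x r) q0 q)) ler_normD.
Qed.

Lemma integrable_running :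
  lebesgue_measure.-integrable `[t0, T]
    (EFin \o (fun s => h s (x s) (u0 s) (at_time u s))).
Proof.
apply: measurable_bounded_integrable => //.
- by rewrite /= lebesgue_measure_itv/=; case: ifP => _; rewrite ?ltry // -EFinB ltry.
- exact: measurable_running.
- exact: running_bounded.
Qed.

End RunningPayoff.

(** * Splitting integrals at a point *)

Section IntegralConcat.
Variable R : realType.
Notation mu := (@lebesgue_measure R).
Implicit Types F G : R -> R.

Lemma Rintegral_eq_co (a b : R) F G :
  mu.-integrable `[a, b] (EFin \o F) -> {in `[a, b[, F =1 G} ->
  \int[mu]_(s in `[a, b]) F s = \int[mu]_(s in `[a, b]) G s.
Proof.
move=> iF FG.
have iF' : mu.-integrable `[a, b[ (EFin \o F).
  by apply: integrableS iF => //; apply: subset_itvl; rewrite bnd_simp.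
rewrite -!Rintegral_itv_bndo_bndc//.
- by apply: eq_Rintegral => s; rewrite inE => sI; exact: FG.
- by apply: eq_integrable iF' => // s; rewrite inE => sI /=; rewrite FG.
Qed.

Lemma Rintegral_eq_oc (a b : R) F G :
  mu.-integrable `[a, b] (EFin \o F) -> {in `]a, b], F =1 G} ->
  \int[mu]_(s in `[a, b]) F s = \int[mu]_(s in `[a, b]) G s.
Proof.
move=> iF FG.
have iF' : mu.-integrable `]a, b] (EFin \o F).
  by apply: integrableS iF => //; apply: subset_itvr; rewrite bnd_simp.
rewrite -!Rintegral_itv_obnd_cbnd//.
- by apply: eq_Rintegral => s; rewrite inE => sI; exact: FG.
- by apply: eq_integrable iF' => // s; rewrite inE => sI /=; rewrite FG.
Qed.

(** Nothing is asked at [c], a null set; this leaves the controls free at a switching time. *)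
Lemma Rintegral_concat (a c b : R) F G1 G2 : a <= c <= b ->
  mu.-integrable `[a, b] (EFin \o F) ->
  {in `[a, c[, F =1 G1} -> {in `]c, b], F =1 G2} ->
  \int[mu]_(s in `[a, b]) F s =
  \int[mu]_(s in `[a, c]) G1 s + \int[mu]_(s in `[c, b]) G2 s.
Proof.
move=> /andP[ac cb] iF FG1 FG2.
have icb : mu.-integrable `[c, b] (EFin \o F).
  by apply: integrableS iF => //; apply: subset_itvr; rewrite bnd_simp.
rewrite -(Rintegral_eq_co _ FG1); last first.
  by apply: integrableS iF => //; apply: subset_itvl; rewrite bnd_simp.
rewrite -(Rintegral_eq_oc icb FG2).
have := Rintegral_itvB iF; move=> /(_ c); rewrite !bnd_simp => /(_ ac cb).
rewrite Rintegral_itv_obnd_cbnd => [<-|]; first by rewrite addrC subrK.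
by apply: integrableS icb => //; apply: subset_itvr; rewrite bnd_simp.
Qed.

End IntegralConcat.

(** * Dynamic programming *)

Section DynamicProgramming.
Variables (R : realType) (T : R) (d n : nat).
Variables (P0 : pseudoMetricType R) (P : 'I_n -> pseudoMetricType R).
Variable f : R -> 'rV[R]_d -> P0 -> (forall i : 'I_n, P i) -> 'rV[R]_d.
Variable g : 'I_n.+1 -> R -> 'rV[R]_d -> P0 -> (forall i : 'I_n, P i) -> R.
Variable sigma : 'I_n.+1 -> 'rV[R]_d -> R.
Hypotheses (T_gt0 : 0 < T).
Hypotheses (cP0 : compact [set: P0]) (cP : forall i, compact [set: P i]).
Hypotheses (fc : jcont T f) (gc : forall j, jcont T (g j)).
Hypothesis wp : well_posed T f.

Notation J := (Jpay T f g sigma).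
Notation x_ := (traj T f).

Lemma jcont_coord k : jcont T (fun t x p0 p => f t x p0 p 0 k : R).
Proof.
move=> t x p0 p tT e e0; have [del del0 hdel] := fc x p0 p tT e0.
exists del => // t' x' p0' p' t'T tt' xx' pp' qq'.
have := hdel t' x' p0' p' t'T tt' xx' pp' qq'; apply: le_lt_trans.
set v := f t x p0 p; set v' := f t' x' p0' p'.
rewrite [leLHS](_ : _ = `|(v - v') 0 k|); last by rewrite !mxE.
rewrite [leRHS]/Num.norm/= mx_normrE.
exact: (le_bigmax _ (fun ij => `|(v - v') ij.1 ij.2|) (0, k)).
Qed.

Lemma trajP t0 x0 u0 u : 0 <= t0 <= T -> adm0 T t0 u0 -> adm T t0 u ->
  is_traj T f t0 x0 u0 u (x_ t0 x0 u0 u).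
Proof.
by move=> t0T au0 au; apply: xgetPex; have [] := wp x0 t0T au0 au.
Qed.

Lemma traj_start t0 x0 u0 u : 0 <= t0 <= T -> adm0 T t0 u0 -> adm T t0 u ->
  x_ t0 x0 u0 u t0 = x0.
Proof.
move=> t0T au0 au; have [_ xE] := trajP x0 t0T au0 au.
apply/rowP => k; have [_ tT] := andP t0T.
by rewrite (xE t0) ?lexx//= set_itv1 Rintegral_set1 addr0.
Qed.

Lemma sub_meas_ctrl (Q : pseudoMetricType R) (v : R -> Q) t0 t1 : t0 <= t1 ->
  meas_ctrl T t0 v -> meas_ctrl T t1 v.
Proof.
move=> t01 mv O oO.
rewrite [X in measurable X](_ : _ = `[t1, T] `&` (`[t0, T] `&` v @^-1` O)).
  by apply: measurableI => //; exact: mv.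
apply/seteqP; split=> s /=; last by move=> [? []].
by move=> [sI sO]; do 2 split => //; apply: subset_itvr sI; rewrite bnd_simp.
Qed.

Section Concat.
Variables (t : R) (x0 : 'rV[R]_d) (u0 v0 w0 : R -> P0) (u v w : profile P).
Hypotheses (tT : 0 <= t <= T).
Hypotheses (au0 : adm0 T 0 u0) (au : adm T 0 u).
Hypotheses (av0 : adm0 T 0 v0) (av : adm T 0 v).
Hypotheses (aw0 : adm0 T t w0) (aw : adm T t w).
Hypothesis uv0 : forall s, 0 <= s < t -> v0 s = u0 s.
Hypothesis uv : forall i s, 0 <= s < t -> v i s = u i s.
Hypothesis vw0 : forall s, t < s <= T -> v0 s = w0 s.
Hypothesis vw : forall i s, t < s <= T -> v i s = w i s.

Let y := x_ t (x_ 0 x0 u0 u t) w0 w.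
Let z s := if s <= t then x_ 0 x0 u0 u s else y s.

Let zle s : s <= t -> z s = x_ 0 x0 u0 u s.
Proof. by rewrite /z => ->. Qed.

(** At [t] the two pieces meet because [y] starts from the state reached there. *)
Let zge s : t <= s -> z s = y s.
Proof.
rewrite le_eqVlt => /predU1P[<-|ts]; last by rewrite /z leNgt ts.
by rewrite zle// /y traj_start.
Qed.

Let oT : (0 <= 0 :> R) && (0 <= T). Proof. by rewrite lexx ltW. Qed.

Let zc : {within `[0, T], continuous z}.
Proof.
have [t_ge0 t_leT] := andP tT.
have -> : `[0, T]%classic = `[0, t]%classic `|` `[t, T]%classic.
  apply/seteqP; split=> s; rewrite /= !in_itv/=.
    by move=> /andP[-> ->]; rewrite andbT; apply/orP; exact: le_total.
  by move=> [/andP[-> /le_trans->]|/andP[/(le_trans t_ge0)-> ->]].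
apply: withinU_continuous; try exact: interval_closed.
  apply: (@subspace_eq_continuous _ _ _ (x_ 0 x0 u0 u)).
    by move=> s; rewrite inE/= in_itv/= => /andP[_ st]; exact/esym/zle.
  have [+ _] := trajP x0 oT au0 au; apply: continuous_subspaceW.
  by apply: subset_itvl; rewrite bnd_simp.
apply: (@subspace_eq_continuous _ _ _ y).
  by move=> s; rewrite inE/= in_itv/= => /andP[ts _]; exact/esym/zge.
by have [] := trajP (x_ 0 x0 u0 u t) tT aw0 aw.
Qed.

Let before (h : R -> 'rV[R]_d -> P0 -> (forall i : 'I_n, P i) -> R) s :
  0 <= s < t -> h s (z s) (v0 s) (at_time v s) =
    h s (x_ 0 x0 u0 u s) (u0 s) (at_time u s).
Proof.
move=> /[dup] st /andP[_ /ltW /zle ->]; rewrite uv0//; congr h.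
by apply: functional_extensionality_dep => i; rewrite /at_time uv.
Qed.

Let after (h : R -> 'rV[R]_d -> P0 -> (forall i : 'I_n, P i) -> R) s :
  t < s <= T -> h s (z s) (v0 s) (at_time v s) =
    h s (y s) (w0 s) (at_time w s).
Proof.
move=> /[dup] st /andP[/ltW /zge -> _]; rewrite vw0//; congr h.
by apply: functional_extensionality_dep => i; rewrite /at_time vw.
Qed.

Let integral_before (h : R -> 'rV[R]_d -> P0 -> (forall i : 'I_n, P i) -> R) s :
  jcont T h -> s <= t ->
  \int[lebesgue_measure]_(r in `[0, s]) h r (z r) (v0 r) (at_time v r) =
  \int[lebesgue_measure]_(r in `[0, s])
    h r (x_ 0 x0 u0 u r) (u0 r) (at_time u r).
Proof.
move=> hc st; apply: Rintegral_eq_co.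
  apply: integrableS (integrable_running cP0 cP hc (lexx 0) zc av0 av) => //.
  by apply: subset_itvl; rewrite bnd_simp (le_trans st)//; case/andP: tT.
by move=> r; rewrite in_itv/= => /andP[r0 rs]; rewrite before// r0 (lt_le_trans rs).
Qed.

Let integral_after (h : R -> 'rV[R]_d -> P0 -> (forall i : 'I_n, P i) -> R) s :
  jcont T h -> t <= s <= T ->
  \int[lebesgue_measure]_(r in `[0, s]) h r (z r) (v0 r) (at_time v r) =
  \int[lebesgue_measure]_(r in `[0, t])
    h r (x_ 0 x0 u0 u r) (u0 r) (at_time u r) +
  \int[lebesgue_measure]_(r in `[t, s]) h r (y r) (w0 r) (at_time w r).
Proof.
move=> hc /andP[ts sT]; have [t0 _] := andP tT.
apply: Rintegral_concat; first by rewrite t0.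
- apply: integrableS (integrable_running cP0 cP hc (lexx 0) zc av0 av) => //.
  by apply: subset_itvl; rewrite bnd_simp.
- by move=> r; rewrite in_itv/= => rt; rewrite before.
- move=> r; rewrite in_itv/= => /andP[tr rs]; rewrite after// tr.
  exact: le_trans sT.
Qed.

Let z_traj : is_traj T f 0 x0 v0 v z.
Proof.
split; first exact: zc.
move=> s /andP[s0 sT] k; have [st|/ltW ts] := leP s t.
  have [_ xE] := trajP x0 oT au0 au.
  by rewrite zle// xE ?s0// (integral_before (jcont_coord k) st).
have [_ yE] := trajP (x_ 0 x0 u0 u t) tT aw0 aw.
have [_ xE] := trajP x0 oT au0 au.
by rewrite zge// yE ?ts// xE// (integral_after (jcont_coord k)) ?ts// addrA.
Qed.

(** The glued path [z] solves the equation of [(v0, v)], hence is its trajectory by uniqueness, and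
    the running payoff splits at [t]. The controls need not match at [t] itself, which suits a
    switching time known only as a supremum. *)
Lemma Jpay_concat j :
  J j 0 x0 v0 v = zpay T f g j t 0 x0 u0 u + J j t (x_ 0 x0 u0 u t) w0 w.
Proof.
have [t_ge0 t_leT] := andP tT.
have zE s : 0 <= s <= T -> traj T f 0 x0 v0 v s = z s.
  have [_] := wp x0 oT av0 av; apply; last exact: z_traj.
  exact: trajP.
rewrite /Jpay zE ?lexx ?andbT ?ltW// zge// addrCA; congr (_ + _).
rewrite -[RHS](integral_after (gc j)) ?lexx ?andbT//.
apply: eq_Rintegral => s; rewrite inE/= in_itv/= => sI.
by rewrite zE.
Qed.

End Concat.

(** * From Nash equilibria to C *)

(** Outside [A] only times from [t1] on remain, where [w] is measurable. A general [A] covers both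
    []-oo, t[] and [agree w], which may or may not contain its endpoint. *)
Lemma meas_ctrl_patch (Q : pseudoMetricType R) (v w : R -> Q) t0 t1 (A : set R) :
  t0 <= t1 -> measurable A -> (forall s, t0 <= s < t1 -> A s) ->
  meas_ctrl T t0 v -> meas_ctrl T t1 w -> meas_ctrl T t0 (patch w A v).
Proof.
move=> t01 mA tA mv mw O oO.
rewrite [X in measurable X](_ : _ =
  ((`[t0, T] `&` v @^-1` O) `&` A) `|` ((`[t1, T] `&` w @^-1` O) `&` ~` A)).
  apply: measurableU; apply: measurableI; [exact: mv|by []|exact: mw|].
  exact: measurableC.
apply/seteqP; split=> s; rewrite /preimage /patch/= !in_itv/=.
  case: ifPn => [|/negP]; rewrite inE => As [/andP[ts sT] Os]; [left|right].
    by rewrite ts.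
  rewrite sT andbT leNgt; split => //; split => //.
  by apply/negP => st; apply: As; apply: tA; rewrite ts.
move=> [[[sI Os]]|[[/andP[ts sT] Os]]] As.
  by rewrite mem_set.
by rewrite memNset// sT (le_trans t01 ts).
Qed.

Lemma deviateE (u : profile P) i (v : R -> P i) : deviate u v i = v.
Proof. exact: dfwithin. Qed.

Lemma deviate_neq (u : profile P) i (v : R -> P i) j :
  i != j -> deviate u v j = u j.
Proof. exact: dfwithout. Qed.

Lemma adm_deviate t0 (u : profile P) i (v : R -> P i) :
  adm T t0 u -> meas_ctrl T t0 v -> adm T t0 (deviate u v).
Proof.
move=> au mv j; have [<-|ij] := eqVneq i j; first by rewrite deviateE.
by rewrite deviate_neq.
Qed.

Lemma sub_adm t0 t1 (u : profile P) : t0 <= t1 -> adm T t0 u -> adm T t1 u.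
Proof. by move=> t01 au i; apply: (sub_meas_ctrl t01); exact: au. Qed.

Definition splice (t : R) (u w : profile P) : profile P :=
  fun i => patch (w i) `]-oo, t[ (u i).

Lemma splice_lt t u w i s : s < t -> splice t u w i s = u i s.
Proof. by move=> st; rewrite /splice /patch mem_set//= in_itv. Qed.

Lemma splice_ge t u w i s : t <= s -> splice t u w i s = w i s.
Proof.
by move=> ts; rewrite /splice /patch memNset//= in_itv/= ltNge ts.
Qed.

(** A unilateral deviation from time [t] on is thus a unilateral deviation on the whole interval, to
    which the Nash inequality applies. *)
Lemma splice_deviate t u i (v : R -> P i) :
  splice t u (deviate u v) = deviate u (patch v `]-oo, t[ (u i)).
Proof.
apply: functional_extensionality_dep => j; rewrite /splice.
have [<-|ij] := eqVneq i j; first by rewrite !deviateE.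
by rewrite !deviate_neq//; apply/funext => s; rewrite /patch; case: ifP.
Qed.

Lemma adm_splice t u w : 0 <= t -> adm T 0 u -> adm T t w ->
  adm T 0 (splice t u w).
Proof.
move=> t0 au aw i; apply: (meas_ctrl_patch t0) => //.
by move=> s /andP[_ st]; rewrite /= in_itv.
Qed.

Lemma nonanticipative_splice (alpha : profile P -> R -> P0) t u : 0 <= t -> adm T 0 u ->
  nonanticipative T 0 alpha ->
  nonanticipative T t (fun w => alpha (splice t u w)).
Proof.
move=> t0 au [aalpha nalpha]; split=> [w aw|w w' tau aw aw' /andP[ttau tauT] ww' s].
  by apply: (sub_meas_ctrl t0); apply: aalpha; exact: (adm_splice t0 au aw).
move=> /andP[ts stau]; apply: (nalpha _ _ tau).
- exact: (adm_splice t0 au aw).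
- exact: (adm_splice t0 au aw').
- by rewrite (le_trans t0).
- move=> i r /andP[r0 rtau]; have [rt|tr] := ltP r t; first by rewrite !splice_lt.
  by rewrite !splice_ge// ww'// tr.
- by rewrite (le_trans t0).
Qed.

Lemma Nash_Cset x0 (alpha : profile P -> R -> P0) u : nonanticipative T 0 alpha ->
  Nash_set T f g sigma x0 alpha u -> Cset T f g sigma x0 (alpha u, u).
Proof.
move=> nalpha [au nash]; have [aalpha halpha] := nalpha.
split; first exact: aalpha.
split=> //= t /[dup] tT /andP[t0 tleT] i.
apply: le_trans (_ : _ <= dev_sup T f g sigma t (traj T f 0 x0 (alpha u) u t) i u
    (fun w => alpha (splice t u w)))%E _.
  apply: ereal_inf_lbound; exists (fun w => alpha (splice t u w)) => //.
  exact: (nonanticipative_splice t0 au nalpha).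
apply: ge_ereal_sup => _ [v mv <-]; rewrite lee_fin splice_deviate.
set v' := patch _ _ _.
have mv' : meas_ctrl T 0 v'.
  by apply: (meas_ctrl_patch t0) => // s /andP[_ st]; rewrite /= in_itv.
have adv' := adm_deviate au mv'.
have dE : deviate u v' = splice t u (deviate u v) by rewrite splice_deviate.
have := nash i v' mv'.
(* Both sides of the Nash inequality collect the same payoff before [t]; it cancels and leaves the
   inequality between the tails. *)
rewrite (@Jpay_concat t x0 (alpha u) (alpha (deviate u v')) (alpha (deviate u v'))
  u (deviate u v') (deviate u v))//.
- rewrite [leRHS](@Jpay_concat t x0 (alpha u) (alpha u) (alpha u) u u u)//.
  + by rewrite lerD2l.
  + exact: aalpha.
  + exact: aalpha.
  + by apply: (sub_meas_ctrl t0); exact: aalpha.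
  + exact: sub_adm au.
- exact: aalpha.
- exact: aalpha.
- by apply: (sub_meas_ctrl t0); exact: aalpha.
- by apply: adm_deviate => //; exact: sub_adm au.
(* Up to [s < t] the deviating profile is still [u], so the leader has not reacted yet. *)
- move=> s /andP[s0 st]; apply: (halpha _ _ s) => //.
  + by rewrite s0 (le_trans (ltW st)).
  + by move=> j r /andP[r0 rs]; rewrite dE splice_lt// (le_lt_trans rs).
  + by rewrite s0 lexx.
- by move=> j s /andP[s0 st]; rewrite dE splice_lt.
- by move=> j s /andP[/ltW ts sT]; rewrite dE splice_ge.
Qed.

(** * From C to Nash equilibria *)

Section Punishment.
Hypothesis va : value_attained T f g sigma.
Variables (x0 : 'rV[R]_d) (u0 : R -> P0) (u : profile P).
Hypothesis uC : Cset T f g sigma x0 (u0, u).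

Let au0 : adm0 T 0 u0. Proof. by case: uC. Qed.
Let au : adm T 0 u. Proof. by case: uC => _ []. Qed.

(** Choice fixes one optimal response for each time and deviator, starting from the state reached
    along [(u0, u)]. *)
Lemma optimal_response :
  exists opt : R * 'I_n -> profile P -> R -> P0,
    forall t i, 0 <= t <= T -> nonanticipative T t (opt (t, i)) /\
      dev_sup T f g sigma t (x_ 0 x0 u0 u t) i u (opt (t, i)) =
      Vlow T f g sigma t (x_ 0 x0 u0 u t) i u.
Proof.
suff /choice[opt optP] : forall ti : R * 'I_n, exists a : profile P -> R -> P0,
    0 <= ti.1 <= T -> nonanticipative T ti.1 a /\
      dev_sup T f g sigma ti.1 (x_ 0 x0 u0 u ti.1) ti.2 u a =
      Vlow T f g sigma ti.1 (x_ 0 x0 u0 u ti.1) ti.2 u.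
  by exists opt => t i; exact: (optP (t, i)).
move=> [t i] /=; have [tT|ntT] := boolP (0 <= t <= T); last first.
  by exists (fun=> u0).
have aut : adm T t u by apply: sub_adm au; case/andP: tT.
have [a [na [aE _]]] := va (x_ 0 x0 u0 u t) i tT aut.
by exists a.
Qed.

(** A down-closed set containing all negative times. The bound [r <= T] makes differences after [T]
    invisible, so the set is the whole line once it contains [T]. *)
Definition agree (w : profile P) : set R :=
  [set s | forall i r, 0 <= r <= s -> r <= T -> w i r = u i r].

(* If w already differs from u at time 0, the set is empty and sup set0 = 0. *)
Definition deviation_time (w : profile P) : R := sup (agree w `&` `[0, T]).

(* The set of s with ~ agree w s may be open on the left, so a first deviator is
   one who has left u before every such s.  This depends only on w restricted
   to [0, s], for any one such s, which makes punish nonanticipative. *)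
Definition deviates (w : profile P) (i : 'I_n) :=
  forall s, ~ agree w s -> exists2 r, 0 <= r <= s & r <= T /\ w i r <> u i r.

(** Among simultaneous first deviators [pick] takes one by a rule depending only on the predicate.
    If it finds none, [w] agrees with [u] on [[0, T]] and the fallback [u0] is never consulted. *)
Definition punish (opt : R * 'I_n -> profile P -> R -> P0) (w : profile P) :=
  patch (if [pick i | `[< deviates w i >]] is Some i
         then opt (deviation_time w, i) w else u0) (agree w) u0.

Lemma agree_le w s s' : s' <= s -> agree w s -> agree w s'.
Proof.
by move=> ss' ws i r /andP[r0 rs]; apply: ws; rewrite r0 (le_trans rs).
Qed.

Lemma measurable_agree w : measurable (agree w).
Proof.
apply: is_interval_measurable => a b _ wb c /andP[_ cb].
exact: agree_le wb.
Qed.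

Lemma agree_has_ub w : has_ubound (agree w `&` `[0, T]).
Proof. by exists T => s [_]; rewrite /= in_itv/= => /andP[]. Qed.

Lemma deviation_timeT w : 0 <= deviation_time w <= T.
Proof.
rewrite /deviation_time.
have [->|/set0P wn0] := eqVneq (agree w `&` `[0, T]) set0.
  by rewrite sup0 lexx ltW.
apply/andP; split.
  have [s [ws sI]] := wn0; apply: (@le_trans _ _ s).
    by move: sI; rewrite /= in_itv/= => /andP[].
  by apply: ub_le_sup => //; exact: agree_has_ub.
by apply: ge_sup => // s [_]; rewrite /= in_itv/= => /andP[].
Qed.

Lemma agree_before w s : 0 <= s < deviation_time w -> agree w s.
Proof.
move=> /andP[s0 sw].
have /set0P wn0 : (agree w `&` `[0, T]) != set0.
  apply/eqP => w0; move: sw; rewrite /deviation_time w0 sup0.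
  by rewrite ltNge s0.
have [r [wr _] sr] := sup_gt wn0 sw.
by apply: agree_le wr; exact: ltW.
Qed.

Lemma deviation_time_le w s : 0 <= s -> ~ agree w s -> deviation_time w <= s.
Proof.
move=> s0 ws; rewrite leNgt; apply/negP => sw.
by apply: ws; apply: agree_before; rewrite s0.
Qed.

Lemma not_agree_after w s : deviation_time w < s <= T -> ~ agree w s.
Proof.
move=> /andP[ws sT] as_; have /andP[w0 _] := deviation_timeT w.
have s0 : 0 <= s by exact: le_trans (ltW ws).
move: ws; rewrite ltNge => /negP; apply.
apply: ub_le_sup; first exact: agree_has_ub.
by split => //; rewrite /= in_itv/= sT s0.
Qed.

Lemma agree_local w w' s : (forall i r, 0 <= r <= s -> w i r = w' i r) ->
  agree w s -> agree w' s.
Proof.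
by move=> ww' ws i r rs rT; rewrite -ww'// ws.
Qed.

(** A first deviator has left [u] by time [s] already, so later times add no condition, and up to
    [s] the two profiles coincide. *)
Lemma deviates_local w w' s : (forall i r, 0 <= r <= s -> w i r = w' i r) ->
  ~ agree w s -> forall i, deviates w i -> deviates w' i.
Proof.
move=> ww' ws i wi r wr; have [rs|/ltW sr] := leP r s.
  have [|q /andP[q0 qr] [qT wq]] := wi r.
    apply: contra_not wr; apply: agree_local => j q /andP[q0 qr].
    by apply: ww'; rewrite q0 (le_trans qr).
  exists q; first by rewrite q0.
  by split => //; rewrite -ww'// q0 (le_trans qr).
have [q /andP[q0 qs] [qT wq]] := wi s ws.
exists q; first by rewrite q0 (le_trans qs).
by split => //; rewrite -ww'// q0.
Qed.

(** Both sets lie below [s], where the profiles coincide. Hence the deviation times are equal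
    too. *)
Lemma agree_eq w w' s : (forall i r, 0 <= r <= s -> w i r = w' i r) ->
  ~ agree w s -> agree w = agree w'.
Proof.
move=> ww' ws.
have w's : ~ agree w' s.
  by apply: contra_not ws; apply: agree_local => i r rs; rewrite ww'.
apply/seteqP; split=> r wr.
  have [rs|/ltW sr] := leP r s; last by exfalso; apply: ws; exact: agree_le wr.
  apply: agree_local wr => i q /andP[q0 qr].
  by apply: ww'; rewrite q0 (le_trans qr).
have [rs|/ltW sr] := leP r s; last by exfalso; apply: w's; exact: agree_le wr.
apply: agree_local wr => i q /andP[q0 qr].
by rewrite ww'// q0 (le_trans qr).
Qed.

Lemma deviator_exists w : ~ agree w T -> exists i, deviates w i.
Proof.
move=> wT; apply: contrapT => /forallNP nd.
(* Otherwise nobody would deviate up to the smallest of the times s i. *)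
have /choice[s sP] : forall i, exists s, ~ agree w s /\
    forall r, 0 <= r <= s -> r <= T -> w i r = u i r.
  move=> i; have /existsNP[s /not_implyP[ws ns]] := nd i; exists s; split => // r rs rT.
  by apply: contrapT => wr; apply: ns; exists r.
(* Without followers agreement is vacuous; otherwise the minimum below is over a nonempty set. *)
have [i0 _] : exists i : 'I_n, True.
  apply: contrapT => /forallNP ni; apply: wT => i; by have := ni i.
case: (arg_minP s (erefl : xpredT i0)) => i _ imin.
apply: (sP i).1 => j r /andP[r0 rs] rT; apply: (sP j).2 => //.
by rewrite r0 (le_trans rs)// imin.
Qed.

Lemma punish_nonanticipative opt :
  (forall t i, 0 <= t <= T -> nonanticipative T t (opt (t, i))) ->
  nonanticipative T 0 (punish opt).
Proof.
move=> nopt; split=> [w aw|w w' tau aw aw' /andP[tau0 tauT] ww' s /andP[s0 stau]].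
  have /andP[w0 wT] := deviation_timeT w.
  apply: (meas_ctrl_patch w0) => //; first exact: measurable_agree.
    by move=> s; exact: agree_before.
  case: pickP => [i _|_]; last exact: (sub_meas_ctrl w0 au0).
  by apply: (nopt _ i (deviation_timeT w)).1; exact: (sub_adm w0 aw).
have {}ww' i r : 0 <= r <= s -> w i r = w' i r.
  by move=> /andP[r0 rs]; rewrite ww'// r0 (le_trans rs).
have w'w i r : 0 <= r <= s -> w' i r = w i r by move=> /ww' ->.
(* Either no departure is visible by time [s] and both replies are [u0], or the deviator and the
   deviation time are already determined, and the chosen response is itself nonanticipative. *)
rewrite /punish /patch; have [ws|ws] := pselect (agree w s).
  by rewrite !mem_set//; exact: (agree_local ww' ws).
have w's : ~ agree w' s by apply: contra_not ws; exact: (agree_local w'w).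
rewrite !memNset//.
have -> : [pick i | `[< deviates w i >]] = [pick i | `[< deviates w' i >]].
  apply: eq_pick => i; apply/asbool_equiv_eq; split.
    exact: (deviates_local ww' ws).
  exact: (deviates_local w'w w's).
case: pickP => // i _; rewrite /deviation_time (agree_eq ww' ws).
rewrite -/(deviation_time w'); have w'T := deviation_timeT w'.
have /andP[w'0 _] := w'T.
apply: ((nopt _ i w'T).2 w w' s).
- exact: (sub_adm w'0 aw).
- exact: (sub_adm w'0 aw').
- by rewrite deviation_time_le//= (le_trans stau).
- by move=> j r /andP[r0 rs]; rewrite ww'// rs (le_trans w'0).
- by rewrite deviation_time_le//=.
Qed.

Lemma punish_self opt : punish opt u = u0.
Proof.
by apply/funext => s; rewrite /punish /patch mem_set.
Qed.

Lemma Cset_Nash : exists alpha, [/\ nonanticipative T 0 alpha, alpha u = u0 &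
  Nash_set T f g sigma x0 alpha u].
Proof.
have [opt optP] := optimal_response.
have nopt t i (tT : 0 <= t <= T) := (optP t i tT).1.
have np := punish_nonanticipative nopt.
exists (punish opt); split => //; first exact: punish_self.
split; first exact: au.
move=> i v mv; rewrite punish_self; set w := deviate u v.
have aw : adm T 0 w by exact: adm_deviate.
have apw : adm0 T 0 (punish opt w) by exact: np.1.
(* A deviation that never leaves [u] on [[0, T]] changes nothing: splitting at [T] gives the same
   expression for both payoffs. *)
have [wT|wT] := pselect (agree w T).
  have TT : 0 <= T <= T by rewrite lexx ltW.
  have auT := sub_adm (ltW T_gt0) au.
  have auT0 := sub_meas_ctrl (ltW T_gt0) au0.
  rewrite (@Jpay_concat T x0 u0 (punish opt w) u0 u w u)//.
  - rewrite [leRHS](@Jpay_concat T x0 u0 u0 u0 u u u)//.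
  - move=> s /andP[s0 sT]; rewrite /punish /patch mem_set//.
    by apply: agree_le wT; exact: ltW.
  - by move=> j s /andP[s0 sT]; apply: wT; rewrite ?s0 ltW.
  - by move=> s /andP[/lt_le_trans/[apply]]; rewrite ltxx.
  - by move=> j s /andP[/lt_le_trans/[apply]]; rewrite ltxx.
have dT := deviation_timeT w; have /andP[d0 dleT] := dT.
set t := deviation_time w in dT d0 dleT.
(* Only follower [i] can have left [u], so [i] is the one picked. *)
have pw : punish opt w = patch (opt (t, i) w) (agree w) u0.
  rewrite /punish; case: pickP => [j /asboolP/(_ _ wT)|].
    move=> [r _ [_ wr]]; have [<-//|ij] := eqVneq i j.
    by exfalso; apply: wr; rewrite /w deviate_neq.
  have [j wj] := deviator_exists wT.
  by move=> /(_ j) /asboolP.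
have aut := sub_adm d0 au.
have aut0 := sub_meas_ctrl d0 au0.
have awt := sub_adm d0 aw.
rewrite (@Jpay_concat t x0 u0 (punish opt w) (opt (t, i) w) u w w)//.
(* The tail of the deviation is one competitor in [dev_sup], which the optimal response reduces to
   the lower value; membership in [Cset] bounds that value by the tail payoff of [(u0, u)]. *)
- rewrite [leRHS](@Jpay_concat t x0 u0 u0 u0 u u u)// lerD2l.
  rewrite -lee_fin; have [_ [_ uV]] := uC.
  apply: le_trans (uV t dT i); rewrite -(optP t i dT).2.
  by apply: ereal_sup_ubound; exists v => //; exact: (sub_meas_ctrl d0 mv).
- have [nt _] := nopt t i dT; exact: (nt w awt).
- by move=> s st; rewrite pw /patch mem_set//; exact: agree_before.
- move=> j s /[dup] /andP[s0 st] /agree_before ws; apply: ws.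
    by rewrite s0 lexx.
  exact: le_trans (ltW st) dleT.
- by move=> s st; rewrite pw /patch memNset//; exact: not_agree_after.
Qed.

End Punishment.

End DynamicProgramming.

Theorem theorem3 (R : realType) (T : R) (d n : nat)
  (P0 : pseudoMetricType R) (P : 'I_n -> pseudoMetricType R)
  (f : R -> 'rV[R]_d -> P0 -> (forall i : 'I_n, P i) -> 'rV[R]_d)
  (g : 'I_n.+1 -> R -> 'rV[R]_d -> P0 -> (forall i : 'I_n, P i) -> R)
  (sigma : 'I_n.+1 -> 'rV[R]_d -> R) (x0 : 'rV[R]_d) :
  0 < T ->
  (* control sets are compact metric spaces *)
  hausdorff_space P0 -> compact [set: P0] ->
  (forall i, hausdorff_space (P i)) -> (forall i, compact [set: P i]) ->
  (* regularity of the data *)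
  jcont T f -> (forall j, jcont T (g j)) -> (forall j, continuous (sigma j)) ->
  f_lipschitz T f -> f_sublinear T f ->
  well_posed T f ->
  (* standing closedness assumption *)
  closed_reach T f g ->
  (* the min and max defining V_i^- are attained *)
  value_attained T f g sigma ->
  (* (1) *)
  (forall (alpha : profile P -> R -> P0) (u : profile P),
     inv_stackelberg T f g sigma x0 alpha u ->
     Cset T f g sigma x0 (alpha u, u) /\
     forall u0 v, Cset T f g sigma x0 (u0, v) ->
       Jpay T f g sigma ord0 0 x0 u0 v <= Jpay T f g sigma ord0 0 x0 (alpha u) u)
  /\
  (* (2) *)
  (forall (u0 : R -> P0) (u : profile P),
     Cset T f g sigma x0 (u0, u) ->
     (forall v0 v, Cset T f g sigma x0 (v0, v) ->
        Jpay T f g sigma ord0 0 x0 v0 v <= Jpay T f g sigma ord0 0 x0 u0 u) ->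
     exists alpha : profile P -> R -> P0,
       nonanticipative T 0 alpha /\ alpha u = u0 /\
       inv_stackelberg T f g sigma x0 alpha u).
Proof.
move=> T0 _ cP0 _ cP fc gc _ _ _ wp _ va.
have toC := Nash_Cset T0 cP0 cP fc gc wp (sigma := sigma).
have toNash := Cset_Nash T0 cP0 cP fc gc wp va.
split=> [alpha u [nalpha [nash Jsup]]|u0 u uC umax].
  split=> [|v0 v vC]; first exact: toC.
  (* Every competitor in [Cset] is an equilibrium outcome, hence is counted in the double
     supremum. *)
  have [a [na av nav]] := toNash _ _ _ vC.
  rewrite -lee_fin Jsup -av.
  apply: le_trans (ereal_sup_ubound (ex_intro2 _ _ a na erefl)).
  by apply: ereal_sup_ubound; exists v.
have [a [na au nau]] := toNash _ _ _ uC.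
exists a; split => //; split => //; split => //; split => //.
(* The value is below the supremum as [(a, u)] is itself a competitor, and above it because every
   equilibrium outcome lies in [Cset]. *)
rewrite au; apply/eqP; rewrite eq_le; apply/andP; split.
  apply: le_trans (ereal_sup_ubound (ex_intro2 _ _ a na erefl)).
  by apply: ereal_sup_ubound; exists u; rewrite ?au.
apply: ge_ereal_sup => _ [b nb <-]; apply: ge_ereal_sup => _ [w wb <-].
by rewrite lee_fin; apply: umax; exact: toC.
Qed.
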